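(* Let $d=d(n)$ be a positive integer depending on the positive integer $n$; asymptotic statements refer to $n\to\infty$. (a) If $d>n^3/2$, then $$1\leq \frac{p_d(n)}{\binom{d+n-2}{d-1}}<\frac{1}{1-\frac{n^3}{2d}}.$$ (b) If $d n^{-2}\to\infty$ as $n\to\infty$, then $\log p_d(n)=(n-1)(\log d-\log n+1)+o(n)$. (c) If $cn^2\leq d\leq Cn^2$ for some positive constants $c$ and $C$, then $\log p_d(n)=n\log n+O(n)$. (d) If $d n^{-2}\to 0$ and $\log d\geq \log n+o(\log n)$ as $n\to\infty$, then $\log p_d(n)=n\log n+o(n\log n)$.
   Context: Let $\mathbb{Z}_+=\{0,1,2,\dots\}$. A set $S\subset\mathbb{Z}_+^d$ is a lower set if whenever $\mathbf{x}\in S$ and $\mathbf{x}'\in\mathbb{Z}_+^d$ satisfies $x'_i\leq x_i$ for all $i$, then $\mathbf{x}'\in S$. For positive integers $d,n$, $p_d(n)$ denotes the number of lower sets in $\mathbb{Z}_+^d$ with exactly $n$ points. $\log$ is the natural logarithm. *)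

(* Defs.v *)
From mathcomp Require Import all_boot.
From Stdlib Require Import Reals.

Set Implicit Arguments.
Unset Strict Implicit.
Unset Printing Implicit Defensive.

Definition box (d n : nat) := {ffun 'I_d -> 'I_n}.

Definition is_lower (d n : nat) (S : {set box d n}) : bool :=
  [forall x in S, forall y : box d n,
     [forall i : 'I_d, (nat_of_ord (y i) <= nat_of_ord (x i))%N] ==> (y \in S)].

(* p_d(n): the number of lower sets of Z_+^d with exactly n points.
   Every lower set with n points lies in the box {0,...,n-1}^d (the chain
   from a point down to the origin along one axis lies in the set), so
   lower sets of Z_+^d with n points are exactly the lower subsets of the
   box with n points. *)
Definition p (d n : nat) : nat :=
  #|[set S : {set box d n} | is_lower S && (#|S| == n)]|.

(* Main.v *)
Require Import Defs.
From mathcomp Require Import all_boot.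
From Stdlib Require Import Reals Lra.
(* [Reals] rebinds [^] on [nat]; importing [ssrnat] again restores [expn]. *)
From mathcomp Require Import ssrnat zify.

(** Split the n - 1 nonzero points of a lower set into those on a coordinate
    axis and those off the axes.  The axis points amount to a d-tuple of
    multiplicities.  An off-axis point is the join of two of its predecessors,
    so it is a 2-subset of the points of smaller degree; ranking the points by
    degree, a lower set with j off-axis points is determined by its
    multiplicities and a j-subset of the 2-subsets of {0, ..., n-1}.  Hence
      p_d(n) <= \sum_j 'C('C(n, 2), j) 'C(d + n - 2 - j, d - 1).
    Comparing each summand with the one for j = 0 gives a geometric series and
    (a); summing with the binomial theorem gives
      d^(n-1) <= (n-1)! p_d(n) <= (d + n^2)^(n-1),
    the lower bound coming from the sets without off-axis points.  With
    Stirling's formula this yields (b), (c) and the upper bound in (d).  The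
    lower bound in (d) counts graphs: r unit vectors and n - 1 - r sums of two
    of them, with r about n^(1-e). *)

Set Implicit Arguments.
Unset Strict Implicit.
Unset Printing Implicit Defensive.

(** * Axis points and off-axis points *)

Definition dominated d n (y x : box d n) := [forall i, (y i <= x i)%N].

Definition off_axis d n (x : box d n) :=
  [exists ik : 'I_d * 'I_d, [&& ik.1 != ik.2, 0 < x ik.1 & 0 < x ik.2]].

Definition on_axis d n (i : 'I_d) (x : box d n) :=
  (0 < x i) && [forall k, (k != i) ==> (x k == 0 :> nat)].

Lemma lowerP d n (S : {set box d n}) :
  reflect (forall x y, x \in S -> dominated y x -> y \in S) (is_lower S).
Proof.
apply: (iffP forall_inP) => [H x y Sx yx | H x Sx].
  by have /forallP/(_ y)/implyP := H x Sx; apply.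
by apply/forallP=> y; apply/implyP; apply: H.
Qed.

Lemma boxP d n (x y : box d n) : (forall i, x i = y i :> nat) -> x = y.
Proof. by move=> H; apply/ffunP=> i; apply/val_inj/H. Qed.

Section Classes.
Variables d n : nat.
Implicit Types (x y : box d n.+1) (S : {set box d n.+1}).

Definition zero_box : box d n.+1 := [ffun => ord0].

(** Exactly one of three cases holds: zero, on a unique axis, off the axes. As a numerical identity
    it can be summed over a set, which gives [card_classes]. *)
Lemma box_classes x :
  (x == zero_box) + \sum_i on_axis i x + off_axis x = 1.
Proof.
have [/existsP[[i k] /= /and3P[ik xi xk]]|/existsPn offN] := boolP (off_axis x).
  rewrite big1 => [|l _]; last first.
    apply/eqP; rewrite eqb0 /on_axis; apply/negP=> /andP[_ /forallP H].
    have := implyP (H i); have := implyP (H k).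
    case: (eqVneq i l) ik => [->|_] ik.
      by rewrite eq_sym ik => /(_ isT)/eqP xk0; rewrite xk0 in xk.
    by move=> _ /(_ isT)/eqP xi0; rewrite xi0 in xi.
  case: eqVneq => // x0; by rewrite x0 ffunE in xi.
rewrite addn0.
case: (eqVneq x zero_box) => [->|x0].
  rewrite big1 // => i _; apply/eqP; rewrite eqb0 /on_axis ffunE //.
have [i xi] : exists i, 0 < x i.
  apply/existsP; rewrite -[[exists _, _]]negbK; apply/negP=> /existsPn H.
  move/eqP: x0; apply; apply: boxP => i; rewrite ffunE /=.
  by have := H i; rewrite lt0n negbK => /eqP.
rewrite add0n (bigD1 i) //= big1 => [|k ki].
  rewrite addn0 /on_axis xi /=; apply/eqP; rewrite eqb1.
  apply/forallP=> k; apply/implyP=> ki.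
  by have := offN (k, i); rewrite /= ki xi andbT lt0n negbK.
apply/eqP; rewrite eqb0 /on_axis; apply/negP=> /andP[_ /forallP/(_ i)].
by rewrite eq_sym ki eqn0Ngt xi.
Qed.

Lemma card_classes S : #|S| =
  (zero_box \in S) + \sum_i #|[set x in S | on_axis i x]|
  + #|[set x in S | off_axis x]|.
Proof.
have cardE (P : pred (box d n.+1)) : #|[set x in S | P x]| = \sum_(x in S) P x.
  rewrite -sum1_card [RHS]big_mkcond [LHS]big_mkcond; apply: eq_bigr=> x _.
  by rewrite inE; case: (x \in S); case: (P x).
have -> : nat_of_bool (zero_box \in S) = \sum_(x in S) (x == zero_box).
  rewrite -cardE; case: (boolP (zero_box \in S)) => zS.
    rewrite (_ : [set x in S | _] = [set zero_box]) ?cards1 //.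
    by apply/setP=> x; rewrite !inE andbC; case: eqVneq => // ->; rewrite zS.
  apply/esym/eqP; rewrite cards_eq0; apply/eqP/setP=> x; rewrite !inE.
  by case: eqVneq => [->|]; rewrite ?(negbTE zS) // andbF.
rewrite cardE (eq_bigr _ (fun i _ => cardE (on_axis i))) exchange_big /=.
rewrite -!big_split /= -sum1_card; apply: eq_bigr => x _.
by rewrite box_classes.
Qed.

Lemma lower_zero S : is_lower S -> 0 < #|S| -> zero_box \in S.
Proof.
move/lowerP=> lS /card_gt0P[x /lS]; apply.
by apply/forallP=> i; rewrite ffunE.
Qed.

(** A lower set meets each axis in an initial segment, so two such segments are nested; a point in
    one but not the other would make the inclusion strict, against equal sizes. *)
Lemma on_axis_eq S S' i : is_lower S -> is_lower S' ->
  #|[set x in S | on_axis i x]| = #|[set x in S' | on_axis i x]| ->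
  forall x, on_axis i x -> x \in S -> x \in S'.
Proof.
move=> /lowerP lS /lowerP lS' eqc x xi xS; apply/negPn/negP=> xS'.
have : [set x in S' | on_axis i x] \proper [set x in S | on_axis i x].
  apply/properP; split; last by exists x; rewrite !inE ?xS ?xi // (negbTE xS').
  apply/subsetP=> y; rewrite !inE => /andP[yS' yi]; rewrite yi andbT.
  have le (u v : box d n.+1) : on_axis i u -> on_axis i v -> u i <= v i -> dominated u v.
    move=> /andP[_ /forallP Hu] _ uv; apply/forallP=> k.
    by case: (eqVneq k i) => [-> //|ki]; have := Hu k; rewrite ki => /eqP ->.
  case: (leqP (y i) (x i)) => yx; first exact: lS _ _ xS (le _ _ yi xi yx).
  by rewrite (lS' _ _ yS' (le _ _ xi yi (ltnW yx))) in xS'.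
by move/proper_card; rewrite eqc ltnn.
Qed.


(** * Encoding the off-axis points *)

Definition degree x := \sum_i x i.

Definition decr x (i : 'I_d) : box d n.+1 :=
  [ffun k => if k == i then inord (x k).-1 else x k].

Lemma decrE x i k : decr x i k = x k - (k == i) :> nat.
Proof.
rewrite ffunE; case: eqP => _; last by rewrite subn0.
by rewrite subn1 inordK // (leq_ltn_trans (leq_pred _)).
Qed.

Lemma degree_decr x i : 0 < x i -> degree (decr x i) < degree x.
Proof.
move=> xi; rewrite /degree (bigD1 i) //= [ltnRHS](bigD1 i) //= decrE eqxx subn1.
rewrite -addSn prednK // leq_add2l leq_sum // => k /negbTE ki.
by rewrite decrE ki subn0.
Qed.

Lemma decr_dominated x i : dominated (decr x i) x.
Proof. by apply/forallP=> k; rewrite decrE leq_subr. Qed.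

(** At most one of the two points is lowered at coordinate [m], so their join is [x]. *)
Lemma maxn_decr x i k m : i != k -> maxn (decr x i m) (decr x k m) = x m.
Proof.
move=> ik; rewrite !decrE; case: (eqVneq m i) ik => [->|mi] => [/negbTE ->|_].
  by rewrite subn0; apply/maxn_idPr/leq_subr.
by rewrite subn0; apply/maxn_idPl/leq_subr.
Qed.

Lemma decr_neq x i k : i != k -> 0 < x i -> decr x i != decr x k.
Proof.
move=> ik xi; apply/eqP=> /(congr1 (fun y : box d n.+1 => y i : nat)) /eqP.
by rewrite !decrE eqxx (negbTE ik) subn0 subn1 ltn_eqF // prednK.
Qed.

(** A fixed choice of two distinct predecessors whose join is [x], for [x] off the axes; other
    points get the default [(x, x)]. *)
Definition parents x : box d n.+1 * box d n.+1 :=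
  if [pick ik : 'I_d * 'I_d | [&& ik.1 != ik.2, 0 < x ik.1 & 0 < x ik.2]]
    is Some ik then (decr x ik.1, decr x ik.2) else (x, x).

Lemma parentsP x : off_axis x ->
  [/\ (parents x).1 != (parents x).2,
      forall m, maxn ((parents x).1 m) ((parents x).2 m) = x m,
      degree (parents x).1 < degree x /\ degree (parents x).2 < degree x,
      dominated (parents x).1 x & dominated (parents x).2 x].
Proof.
rewrite /parents; case: pickP => [[i k] /= /and3P[ik xi xk] _|no /existsP[ik]].
  split; try split; rewrite ?decr_dominated ?degree_decr ?decr_neq // => m.
  exact: maxn_decr.
by rewrite no.
Qed.

(* Ordering a lower set by degree makes the rank of a point depend only on the
   points of smaller or equal degree, so a set can be decoded degree by degree. *)
Definition key x := degree x * #|{: box d n.+1}| + enum_rank x.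

Definition rank S x := #|[set y in S | key y < key x]|.

Lemma key_inj : injective key.
Proof.
move=> x y xy; apply: enum_rank_inj; apply: val_inj => /=.
have := congr1 (modn^~ #|{: box d n.+1}|) xy.
by rewrite /key !modnMDl !modn_small ?ltn_ord.
Qed.

(** In base [#|{: box d n.+1}|] the degree is the leading part of the key and [enum_rank] its last
    digit. *)
Lemma key_degree x y : key x < key y -> degree x <= degree y.
Proof.
apply: contraLR; rewrite -!ltnNge ltnS => yx.
rewrite /key ltnW // (@leq_trans ((degree y).+1 * #|{: box d n.+1}|)) //.
  by rewrite mulSn addnC ltn_add2r ltn_ord.
by rewrite (leq_trans _ (leq_addr _ _)) // leq_mul2r yx orbT.
Qed.

Lemma rank_lt S x : x \in S -> rank S x < #|S|.
Proof.
move=> xS; apply: proper_card; apply/properP; split.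
  by apply/subsetP=> y; rewrite inE => /andP[].
by exists x => //; rewrite inE ltnn andbF.
Qed.

Lemma rank_ltn S x y : x \in S -> key x < key y -> rank S x < rank S y.
Proof.
move=> xS xy; apply: proper_card; apply/properP; split.
  by apply/subsetP=> z; rewrite !inE => /andP[-> /ltn_trans ->].
by exists x; rewrite !inE ?xS ?xy // ltnn.
Qed.

Lemma rank_inj S : {in S &, injective (rank S)}.
Proof.
move=> x y xS yS xy; apply: key_inj; case: (ltngtP (key x) (key y)) => //.
  by move/(rank_ltn xS); rewrite xy ltnn.
by move/(rank_ltn yS); rewrite xy ltnn.
Qed.

Lemma val_inord_rank S x : #|S| = n.+1 -> x \in S ->
  (inord (rank S x) : 'I_n.+1) = rank S x :> nat.
Proof. by move=> cS xS; rewrite inordK // -cS rank_lt. Qed.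

(** * Decoding a lower set by induction on the degree *)

Definition agree_upto l S S' :=
  forall x, degree x < l -> (x \in S) = (x \in S').

Lemma rank_agree l S S' x :
  agree_upto l S S' -> degree x < l -> rank S x = rank S' x.
Proof.
move=> agr xl; congr #|pred_of_set _|; apply/setP=> y; rewrite !inE.
case: (ltnP (key y) (key x)) => [/key_degree yx|]; last by rewrite !andbF.
by rewrite (agr y) // (leq_ltn_trans yx).
Qed.

(** An unordered pair is enough, since joins are symmetric. For a lower set of size [n.+1]
    containing [x], the ranks are below [n.+1] and [inord] loses nothing. *)
Definition rank_pair S x : {set 'I_n.+1} :=
  [set inord (rank S (parents x).1); inord (rank S (parents x).2)].

(** Below the degree of [x] both sets assign the same ranks, and ranks are injective on each set.
    Equal rank pairs thus give the same two parents, possibly swapped, and a point is the join of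
    its parents. *)
Lemma rank_pair_agree S S' x x' :
  is_lower S -> is_lower S' -> #|S| = n.+1 -> #|S'| = n.+1 ->
  off_axis x -> off_axis x' -> x \in S -> x' \in S' ->
  agree_upto (degree x) S S' -> rank_pair S x = rank_pair S' x' -> x = x'.
Proof.
move=> /lowerP lS /lowerP lS' cS cS' /parentsP[+ + + + +] /parentsP[_ + _ + +].
rewrite /rank_pair; case: (parents x) => y z; case: (parents x') => y' z' /=.
move=> yz xE [dy dz] yx zx x'E y'x' z'x' xS x'S' agr.
have yS := lS _ _ xS yx; have zS := lS _ _ xS zx.
have yS' := lS' _ _ x'S' y'x'; have zS' := lS' _ _ x'S' z'x'.
(* No degree bound on [u'] is imposed: the rank of [u] is moved to [S'], where injectivity forces
   [u = u']. *)
have same u u' : u \in S -> degree u < degree x -> u' \in S' ->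
    inord (rank S u) = inord (rank S' u') :> 'I_n.+1 -> u = u'.
  move=> uS du u'S' /(congr1 val); rewrite /= !val_inord_rank //.
  by rewrite (rank_agree agr du) => /rank_inj; apply; rewrite // -agr.
move/setP=> E.
have := E (inord (rank S y)); rewrite !inE eqxx orTb => /esym/orP.
have := E (inord (rank S z)); rewrite !inE eqxx orbT => /esym/orP.
case=> /eqP/same z_; case=> /eqP/same y_.
- by case/eqP: yz; rewrite y_ // z_.
- by apply: boxP => m; rewrite -xE -x'E maxnC z_ // y_.
- by apply: boxP => m; rewrite -xE -x'E z_ // y_.
- by case/eqP: yz; rewrite y_ // z_.
Qed.

Definition rank_pairs S := rank_pair S @: [set x in S | off_axis x].

Lemma card_rank_pairs S : is_lower S -> #|S| = n.+1 ->
  #|rank_pairs S| = #|[set x in S | off_axis x]|.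
Proof.
move=> lS cS; apply: card_in_imset => x y; rewrite !inE.
by move=> /andP[xS ox] /andP[yS oy]; apply: rank_pair_agree.
Qed.

Lemma rank_pair2 S x : is_lower S -> #|S| = n.+1 -> x \in S -> off_axis x ->
  #|rank_pair S x| = 2.
Proof.
move=> /lowerP lS cS xS /parentsP[yz _ _ yx zx].
rewrite cards2 (_ : inord _ != inord _) //; apply: contra yz => /eqP/(congr1 val).
have yS := lS _ _ xS yx; have zS := lS _ _ xS zx.
by rewrite /= !val_inord_rank // => /rank_inj ->.
Qed.

(** Membership is settled degree by degree. The rank pair of an off-axis point of one set is
    realized by some point of the other, which [rank_pair_agree] identifies with it; axis points are
    settled by their number. *)
Lemma lower_eq S S' : is_lower S -> is_lower S' -> #|S| = n.+1 -> #|S'| = n.+1 ->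
  (forall i, #|[set x in S | on_axis i x]| = #|[set x in S' | on_axis i x]|) ->
  rank_pairs S = rank_pairs S' -> S = S'.
Proof.
move=> lS lS' cS cS' axS rpS.
suff agr l : agree_upto l S S' by apply/setP=> x; apply: (agr (degree x).+1).
elim: l => // l IH x xl.
have agr : agree_upto (degree x) S S' by move=> y yx; apply: IH (leq_trans yx xl).
have agr' : agree_upto (degree x) S' S by move=> y /agr ->.
have := box_classes x; case: (boolP (off_axis x)) => ox.
  move=> _; apply/idP/idP=> xS.
    have : rank_pair S x \in rank_pairs S by apply: imset_f; rewrite inE xS.
    rewrite rpS => /imsetP[y]; rewrite inE => /andP[yS' oy].
    by move/rank_pair_agree => ->.
  have : rank_pair S' x \in rank_pairs S' by apply: imset_f; rewrite inE xS.
  rewrite -rpS => /imsetP[y]; rewrite inE => /andP[yS oy].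
  by move/rank_pair_agree => ->.
case: (eqVneq x zero_box) => [-> _|_]; first by rewrite !lower_zero ?cS ?cS'.
rewrite addn0 add0n => sum1.
have [i xi] : exists i, on_axis i x.
  apply/existsP; rewrite -[[exists _, _]]negbK; apply/negP=> /existsPn H.
  by move: sum1; rewrite big1 // => i _; rewrite (negbTE (H i)).
by apply/idP/idP; apply: on_axis_eq xi.
Qed.

End Classes.

Lemma p_upper d n : p d.+1 n.+1 <=
  \sum_(j < n.+1) 'C('C(n.+1, 2), j) * 'C(d + (n - j), d).
Proof.
rewrite /p; set L := [set S | _].
have cardL (S : {set box d.+1 n.+1}) : S \in L ->
    \sum_i #|[set x in S | on_axis i x]| + #|[set x in S | off_axis x]| = n.
  rewrite inE => /andP[lS /eqP cS]; have := card_classes S.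
  by rewrite lower_zero ?cS // add1n addSn => -[].
pose o (S : {set box d.+1 n.+1}) : 'I_n.+1 := inord #|[set x in S | off_axis x]|.
have oE S : S \in L -> o S = #|[set x in S | off_axis x]| :> nat.
  by move=> SL; rewrite inordK // ltnS -[leqRHS](cardL S) // leq_addl.
(* Lower sets are sorted by their number [j] of off-axis points. *)
rewrite -sum1_card (partition_big o predT) //=; apply: leq_sum => j _.
rewrite sum1dep_card; set Lj := [set S | _].
(* The multiplicities sum to [n - j], the origin taking one of the [n.+1] points, so each fits in
   ['I_(n - j).+1]. *)
pose code (S : {set box d.+1 n.+1}) :=
  ([tuple inord #|[set x in S | on_axis i x]| | i < d.+1] : d.+1.-tuple 'I_(n - j).+1,
   rank_pairs S).
have tE S i : S \in Lj -> tnth (code S).1 i = #|[set x in S | on_axis i x]| :> nat.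
  rewrite inE => /andP[SL /eqP oj]; rewrite tnth_mktuple inordK //.
  rewrite ltnS -[X in _ <= X - _](cardL S) // -oj oE // addnK.
  by rewrite (bigD1 i) //= leq_addr.
have inj : {in Lj &, injective code}.
  move=> S S' SL SL' E; move: (SL) (SL'); rewrite !inE.
  move=> /andP[/andP[lS /eqP cS] _] /andP[/andP[lS' /eqP cS'] _].
  apply: lower_eq => //; last by case: E.
  by move=> i; rewrite -!tE // E.
rewrite -(card_in_imset inj).
set T := [set t : d.+1.-tuple 'I_(n - j).+1 | \sum_(i <- t) i == n - j].
set E := [set E : {set {set 'I_n.+1}} | E \subset [set B : {set 'I_n.+1} | #|B| == 2] & #|E| == j].
suff sub : code @: Lj \subset setX T E.
  apply: leq_trans (subset_leq_card sub) _.
  by rewrite cardsX card_ord_partitions cards_draws card_draws card_ord mulnC.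
apply/subsetP=> _ /imsetP[S SLj ->]; rewrite inE.
move: (SLj); rewrite inE => /andP[SL /eqP oj].
have /andP[lS /eqP cS] : is_lower S && (#|S| == n.+1) by move: SL; rewrite inE.
apply/andP; split; rewrite inE.
  rewrite big_tuple (eq_bigr _ (fun i _ => tE S i SLj)).
  by rewrite -[X in _ == X - _](cardL S) // -oj oE // addnK.
rewrite card_rank_pairs // -oE // oj eqxx andbT.
apply/subsetP=> B /imsetP[x]; rewrite inE => /andP[xS ox] ->.
by rewrite inE rank_pair2.
Qed.

(** * Lower bounds *)

Definition axis_set d n (t : d.+1.-tuple 'I_n.+1) : {set box d.+1 n.+1} :=
  [set x | ~~ off_axis x & [forall i, x i <= tnth t i]].

Lemma axis_set_lower d n (t : d.+1.-tuple 'I_n.+1) : is_lower (axis_set t).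
Proof.
apply/lowerP=> x y; rewrite !inE => /andP[ox /forallP xt] /forallP yx.
apply/andP; split; last by apply/forallP=> i; apply: leq_trans (yx i) (xt i).
apply: contra ox => /existsP[ik /and3P[ik' yi yk]]; apply/existsP; exists ik.
by rewrite ik' (leq_trans yi (yx _)) (leq_trans yk (yx _)).
Qed.

Lemma card_axis_set_on d n (t : d.+1.-tuple 'I_n.+1) i :
  #|[set x in axis_set t | on_axis i x]| = tnth t i.
Proof.
pose f (k : 'I_(tnth t i)) : box d.+1 n.+1 :=
  [ffun l => if l == i then inord k.+1 else ord0].
have fE k l : f k l = (if l == i then k.+1 else 0) :> nat.
  by rewrite ffunE; case: eqP => // _; rewrite inordK // ltnS (leq_trans (ltn_ord k)) // -ltnS.
have f_inj : injective f.
  move=> k k' /(congr1 (fun y : box d.+1 n.+1 => y i : nat)); rewrite !fE eqxx.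
  by move=> [] /val_inj.
rewrite -[RHS]card_ord -(card_imset _ f_inj); congr #|pred_of_set _|.
apply/setP=> x; rewrite !inE; apply/idP/imsetP.
  case/andP=> /andP[_ /forallP xt] /andP[xi /forallP x0].
  have xlt : (x i).-1 < tnth t i by rewrite prednK.
  exists (Ordinal xlt) => //; apply: boxP => l; rewrite fE /=.
  by case: (eqVneq l i) => [->|li]; [rewrite prednK | have := x0 l; rewrite li => /eqP].
case=> k _ ->; apply/andP; split; last first.
  rewrite /on_axis fE eqxx; apply/forallP=> l; apply/implyP=> /negbTE li.
  by rewrite fE li.
apply/andP; split; last by apply/forallP=> l; rewrite fE; case: eqP => // ->.
apply/existsP=> -[[l m] /= /and3P[lm]]; rewrite !fE.
by case: (eqVneq l i) lm => // ->; case: (eqVneq m i).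
Qed.

(** The sets [axis_set t] with entries of [t] summing to [n] are distinct lower sets: the origin and
    [n] axis points. They account for the term [j = 0] of [p_upper]. *)
Lemma p_lower_axis d n : 'C(d + n, d) <= p d.+1 n.+1.
Proof.
rewrite -card_ord_partitions; set T := [set t | _].
have inj : injective (@axis_set d n).
  move=> t t' E; apply: eq_from_tnth => i; apply: val_inj.
  by rewrite /= -!card_axis_set_on E.
rewrite -(card_imset _ inj); apply/subset_leq_card/subsetP=> _ /imsetP[t tT ->].
rewrite inE axis_set_lower card_classes.
have -> : zero_box d.+1 n \in axis_set t.
  rewrite inE; apply/andP; split; last by apply/forallP=> i; rewrite ffunE.
  by apply/existsP=> -[ik /and3P[_]]; rewrite !ffunE.
rewrite (_ : [set x in _ | off_axis x] = set0) ?cards0 ?addn0; last first.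
  by apply/setP=> x; rewrite !inE -andbA andbCA andNb andbF.
under eq_bigr => i _ do rewrite card_axis_set_on.
by move: tT; rewrite inE big_tuple add1n eqSS.
Qed.

(** * Lower sets built from graphs *)

Definition indicator d n (B : {set 'I_d}) : box d n.+1 := [ffun i => inord (i \in B)].

Lemma indicatorE d n (B : {set 'I_d}) i : 0 < n -> indicator n B i = (i \in B) :> nat.
Proof. by move=> n0; rewrite ffunE inordK //; case: (i \in B). Qed.

Lemma indicator_inj d n : 0 < n -> injective (@indicator d n).
Proof.
move=> n0 B B' E; apply/setP=> i.
have := indicatorE B i n0; rewrite E indicatorE //.
by case: (i \in B); case: (i \in B').
Qed.

(* Graphs on r vertices, viewed as simplicial complexes, through the indicator
   functions of their faces. *)
Lemma p_lower_graph d n r : 0 < n -> r <= d -> r <= n -> 'C('C(r, 2), n - r) <= p d n.+1.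
Proof.
move=> n0 rd rn; pose V := [set i : 'I_d | i < r].
have cV : #|V| = r.
  have inj : injective (widen_ord rd) by move=> i j /(congr1 val) /= /val_inj.
  rewrite -[RHS]card_ord -(card_imset _ inj); congr #|pred_of_set _|.
  apply/setP=> i; rewrite inE; apply/idP/imsetP=> [ir|[j _ ->] /=].
    by exists (Ordinal ir) => //; apply: val_inj.
  exact: ltn_ord.
pose F k := [set B : {set 'I_d} | B \subset V & #|B| == k].
have cF k : #|F k| = 'C(r, k) by rewrite cards_draws cV.
rewrite -(cF 2) -(cards_draws (F 2)); set G := [set E | _].
(* The empty face, all [r] vertices and [n - r] edges make [n.+1] faces; [E] is recovered as the
   faces of size 2. *)
pose cplx (E : {set {set 'I_d}}) := F 0 :|: F 1 :|: E.
pose f E : {set box d n.+1} := @indicator d n @: cplx E.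
have inj : {in G &, injective f}.
  move=> E E' EG EG' /(imset_inj (indicator_inj n0)) /setP H.
  have sub B X : X \in G -> B \in X -> #|B| = 2.
    by rewrite inE => /andP[/subsetP s _] /s; rewrite inE => /andP[_ /eqP].
  apply/setP=> B; have := H B; rewrite !inE.
  case: (eqVneq #|B| 2) => [->|B2]; first by rewrite !andbF.
  move=> _; apply/idP/idP=> [/(sub _ _ EG)|/(sub _ _ EG')] cB;
    by rewrite cB eqxx in B2.
rewrite -(card_in_imset inj); apply/subset_leq_card/subsetP=> _ /imsetP[E EG ->].
have /andP[/subsetP EF /eqP cE] : (E \subset F 2) && (#|E| == n - r).
  by move: EG; rewrite inE.
rewrite inE; apply/andP; split.
  apply/lowerP=> _ y /imsetP[B BE ->] /forallP yB.
  (* A point below an indicator is the indicator of its support; a proper subset of a face has at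
     most one element, hence lies in [F 0] or [F 1]. *)
  pose B' := [set i | 0 < y i].
  have yE : y = indicator n B'.
    apply: boxP => i; rewrite indicatorE // inE.
    have := yB i; rewrite indicatorE //; case: (i \in B); last by rewrite leqn0 => /eqP ->.
    by case: (nat_of_ord (y i)) => [|[]].
  have sB : B' \subset B.
    apply/subsetP=> i; rewrite inE => yi; have := leq_trans yi (yB i).
    by rewrite indicatorE //; case: (i \in B).
  rewrite yE imset_f //; case: (eqVneq B' B) => [-> //|neB].
  have /andP[BV B2] : (B \subset V) && (#|B| <= 2).
    move: BE; rewrite !inE -orbA => /or3P[/andP[-> /eqP ->]|/andP[-> /eqP ->]|] //.
    by move/EF; rewrite inE => /andP[-> /eqP ->].
  rewrite !inE (subset_trans sB BV) /=.
  have : #|B'| < #|B| by apply: proper_card; rewrite properEneq neB.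
  by move/leq_trans/(_ B2); case: #|B'| => [|[]].
rewrite card_imset; last exact: indicator_inj.
rewrite !cardsU !cF bin0 bin1 cE.
rewrite (_ : F 0 :&: F 1 = set0); last first.
  apply/setP=> B; rewrite !inE; apply/negP=> /andP[/andP[_ /eqP ->]].
  by rewrite andbF.
rewrite (_ : _ :&: E = set0); last first.
  apply/setP=> B; rewrite !inE; apply/negP=> /andP[+ /EF]; rewrite !inE.
  by move=> /orP cB /andP[_ /eqP B2]; case: cB; rewrite B2 andbF.
by rewrite !cards0 !subn0 add1n addSn subnKC.
Qed.

(** * Estimates for the binomial sum *)

Lemma bin_addC d m : 'C(d + m, d) = 'C(d + m, m).
Proof. by rewrite -[RHS]bin_sub ?leq_addl // addnK. Qed.

(** Raising [m] by one multiplies the binomial by [(d + m + 1) / (m + 1)], at least [d.+1 / m.+1];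
    each of the [j] denominators is at most [m + j]. *)
Lemma multichoose_shift d m j :
  d.+1 ^ j * 'C(d + m, d) <= (m + j) ^ j * 'C(d + (m + j), d).
Proof.
elim: j m => [|j IH] m; first by rewrite addn0.
have step : d.+1 * 'C(d + m, d) <= m.+1 * 'C(d + m.+1, d).
  rewrite !bin_addC -mul_bin_diag addnS /=.
  by rewrite leq_mul2r -addSn leq_addr orbT.
rewrite expnSr -mulnA (leq_trans (leq_mul (leqnn _) step)) // mulnCA.
rewrite (leq_trans (leq_mul (leqnn _) (IH _))) // addSnnS.
by rewrite mulnA expnS !leq_mul // addnS ltnS leq_addr.
Qed.

Lemma leq_expn2r m n k : m <= n -> m ^ k <= n ^ k.
Proof. by case: k => // k mn; rewrite leq_exp2r. Qed.

Lemma ffact_le_expn n m : n ^_ m <= n ^ m.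
Proof.
rewrite ffact_prod -[m in leqRHS]card_ord -prod_nat_const.
by apply: leq_prod => i _; apply: leq_subr.
Qed.

Lemma bin_le_expn n m : 'C(n, m) <= n ^ m.
Proof.
by apply: leq_trans (ffact_le_expn n m); rewrite -bin_ffact leq_pmulr ?fact_gt0.
Qed.

Lemma bin2_double n : 2 * 'C(n, 2) = n * n.-1.
Proof. by rewrite mulnC; have := bin_ffact n 2; rewrite !ffactnS ffactn0 muln1. Qed.

(** The summand of index [j] in [p_upper] is at most [B (Q / D) ^ j]. Multiplying by [D ^ n] keeps
    the geometric series in the naturals. *)
Lemma p_upper_ratio d n : n.+1 ^ 3 < 2 * d.+1 ->
  p d.+1 n.+1 * (2 * d.+1 - n.+1 ^ 3) < 2 * d.+1 * 'C(d + n, d).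
Proof.
set D := 2 * d.+1; set Q := n.+1 ^ 3; set B := 'C(d + n, d) => QD.
have term (j : 'I_n.+1) :
    D ^ n * ('C('C(n.+1, 2), j) * 'C(d + (n - j), d)) <= D ^ (n - j) * Q ^ j * B.
  have jn : j <= n by rewrite -ltnS.
  have c1 : 2 ^ j * 'C('C(n.+1, 2), j) <= (n.+1 ^ 2) ^ j.
    apply: leq_trans (leq_mul (leqnn _) (bin_le_expn _ _)) _.
    by rewrite -expnMn leq_expn2r // bin2_double -mulnn leq_mul.
  have c2 : d.+1 ^ j * 'C(d + (n - j), d) <= n.+1 ^ j * B.
    apply: leq_trans (multichoose_shift _ _ _) _.
    by rewrite subnK // leq_mul2r leq_expn2r ?orbT.
  rewrite -{1}(subnK jn) expnD {2}/D expnMn /Q (expnSr _ 2) expnMn.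
  rewrite -!mulnA leq_mul2l (mulnCA (d.+1 ^ j)).
  by rewrite [2 ^ j * _]mulnA leq_mul ?orbT.
have sum_le : D ^ n * p d.+1 n.+1 <= \sum_(j < n.+1) D ^ (n - j) * Q ^ j * B.
  apply: leq_trans (leq_mul (leqnn _) (p_upper d n)) _.
  by rewrite big_distrr leq_sum.
rewrite -(@ltn_pmul2l (D ^ n)) ?expn_gt0 //.
rewrite mulnA mulnC (leq_ltn_trans (leq_mul (leqnn _) sum_le)) //.
(* The sum telescopes to [D ^ n.+1 - Q ^ n.+1]; strictness comes from [Q > 0]. *)
rewrite -big_distrl /= mulnA -subn_exp mulnA -expnSr.
by rewrite ltn_pmul2r ?bin_gt0 ?leq_addr // ltn_subrL !expn_gt0.
Qed.

(** Splitting [n!] as ['C(n, j) j! (n - j)!] turns both binomials of a summand into falling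
    factorials, at most [N ^ j] and [(d + n) ^ (n - j)]; the binomial theorem sums them. *)
Lemma p_upper_expn d n : n`! * p d.+1 n.+1 <= (d.+1 + n.+1 ^ 2) ^ n.
Proof.
set N := 'C(n.+1, 2).
have base : d + n + N <= d.+1 + n.+1 ^ 2.
  have := bin2_double n.+1; rewrite -/N /= -[n.+1 ^ 2]/(n.+1 * n.+1); nia.
apply: leq_trans (leq_mul (leqnn _) (p_upper d n)) _.
apply: leq_trans (leq_expn2r n base); rewrite expnDn big_distrr /=.
apply: leq_sum => j _; have jn : j <= n by rewrite -ltnS.
rewrite -(bin_fact jn) -!mulnA leq_mul2l; apply/orP; right.
rewrite mulnA [leqRHS]mulnC mulnACA leq_mul //.
  by rewrite mulnC bin_ffact ffact_le_expn.
rewrite bin_addC mulnC bin_ffact (leq_trans (ffact_le_expn _ _)) //.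
by rewrite leq_expn2r // leq_add2l leq_subr.
Qed.

Lemma p_lower_expn d n : d.+1 ^ n <= n`! * p d.+1 n.+1.
Proof.
apply: leq_trans (leq_mul (leqnn _) (p_lower_axis d n)).
rewrite bin_addC mulnC bin_ffact ffact_prod.
rewrite -[n in leqLHS]card_ord -prod_nat_const leq_prod // => i _.
by have := ltn_ord i; lia.
Qed.

(** The binomial is the product of the [(n - i) / (m - i)], each at least [n / m]. *)
Lemma expn_le_bin n m : m <= n -> n ^ m <= 'C(n, m) * m ^ m.
Proof.
move=> mn; rewrite -(@leq_pmul2r m`!) ?fact_gt0 //.
rewrite mulnAC bin_ffact -ffactnn !ffact_prod.
rewrite -[X in n ^ X]card_ord -[X in _ * _ ^ X]card_ord -!prod_nat_const -!big_split /=.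
by apply: leq_prod => i _; have := ltn_ord i; nia.
Qed.

(** * Logarithmic bounds *)

Local Open Scope R_scope.

Lemma leq_INR m n : (m <= n)%N -> INR m <= INR n.
Proof. by move/leP/le_INR. Qed.

Lemma INR_muln m n : INR (m * n)%N = INR m * INR n.
Proof. exact: mult_INR. Qed.

Lemma INR_addn m n : INR (m + n)%N = INR m + INR n.
Proof. exact: plus_INR. Qed.

Lemma INR_subn m n : (n <= m)%N -> INR (m - n)%N = INR m - INR n.
Proof. by move/leP/minus_INR. Qed.

Lemma INR_expn m n : INR (m ^ n)%N = INR m ^ n.
Proof. by elim: n => // n IH; rewrite expnS INR_muln IH. Qed.

Lemma INR_gt0 n : (0 < n)%N -> 0 < INR n.
Proof. by move/ltP/lt_0_INR. Qed.

Lemma INR_ge1 n : (0 < n)%N -> 1 <= INR n.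
Proof. exact: (@leq_INR 1). Qed.

Lemma ln_le_sub1 x : 0 < x -> ln x <= x - 1.
Proof. by move=> x0; have := exp_ineq1_le (ln x); rewrite exp_ln //; lra. Qed.

Lemma ln_le x y : 0 < x -> x <= y -> ln x <= ln y.
Proof. by move=> x0 [xy | ->]; [left; apply: ln_increasing | right]. Qed.

Lemma ln_div x y : 0 < x -> 0 < y -> ln (x / y) = ln x - ln y.
Proof.
move=> x0 y0; rewrite /Rdiv ln_mult ?ln_Rinv //; exact: Rinv_0_lt_compat.
Qed.

(** Stirling's formula up to a logarithmic error. In the induction [ln n!] grows by [ln x], and the
    two bounds follow from [x ln (1 + 1/x) <= 1 <= (x + 1) ln (1 + 1/x)]. *)
Lemma ln_fact_bounds n (x := INR n.+1) :
  x * ln x - x - ln x <= ln (INR n`!) <= x * ln x - x + 1.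
Proof.
rewrite /x {x}; elim: n => [|n]; first by rewrite /= ln_1; lra.
rewrite factS INR_muln ln_mult; try exact: INR_gt0 (fact_gt0 _); try exact: INR_gt0.
rewrite (S_INR n.+1); set x := INR n.+1 => IH.
have x0 : 0 < x by apply: INR_gt0.
have E : ln (x + 1) - ln x = ln ((x + 1) / x) by rewrite ln_div; lra.
have E' : ln x - ln (x + 1) = ln (x / (x + 1)) by rewrite ln_div; lra.
have up : ln ((x + 1) / x) <= (x + 1) / x - 1 by apply/ln_le_sub1/Rdiv_lt_0_compat; lra.
have lo : ln (x / (x + 1)) <= x / (x + 1) - 1 by apply/ln_le_sub1/Rdiv_lt_0_compat; lra.
have : x * (ln (x + 1) - ln x) <= x * ((x + 1) / x - 1) by apply: Rmult_le_compat_l; lra.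
have : (x + 1) * (ln x - ln (x + 1)) <= (x + 1) * (x / (x + 1) - 1).
  by apply: Rmult_le_compat_l; lra.
have -> : x * ((x + 1) / x - 1) = 1 by field; lra.
have -> : (x + 1) * (x / (x + 1) - 1) = -1 by field; lra.
lra.
Qed.

(** * Explicit bounds on [ln (p d n)] for fixed [d] and [n] *)

Section Bounds.
Variables d n : nat.
Hypotheses (d0 : (0 < d)%N) (n0 : (0 < n)%N).
Let x := INR n.
Let y := INR d.

Let x1 : 1 <= x. Proof. exact: INR_ge1. Qed.
Let y1 : 1 <= y. Proof. exact: INR_ge1. Qed.

Lemma p_gt0 : (0 < p d n)%N.
Proof.
case: d n d0 n0 => // d' [] // n' _ _.
by apply: leq_trans (p_lower_axis d' n'); rewrite bin_gt0 leq_addr.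
Qed.

Lemma ln_p_upper : ln (INR (p d n)) <= (x - 1) * (ln (y + x ^ 2) - ln x) + x.
Proof.
have := p_gt0; rewrite /x /y; case: d n d0 n0 => // d' [] // n' _ _ p0.
have := leq_INR (p_upper_expn d' n').
rewrite INR_muln INR_expn INR_addn INR_expn => /(ln_le _).
rewrite ln_mult; try exact: INR_gt0 (fact_gt0 _); try exact: INR_gt0.
have z0 : 0 < INR d'.+1 + INR n'.+1 ^ 2.
  by have := INR_ge1 (isT : (0 < d'.+1)%N); nra.
rewrite ln_pow //.
have -> : INR n' = INR n'.+1 - 1 by rewrite S_INR; lra.
have := ln_fact_bounds n'.
have : 0 < INR n'`! * INR (p d'.+1 n'.+1).
  by apply: Rmult_lt_0_compat; apply: INR_gt0; rewrite ?fact_gt0.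
by move=> pos [F _] /(_ pos); nra.
Qed.

Lemma ln_p_lower :
  (x - 1) * (ln y - ln x + 1) - ln x <= ln (INR (p d n)).
Proof.
have := p_gt0; rewrite /x /y; case: d n d0 n0 => // d' [] // n' _ _ p0.
have := leq_INR (p_lower_expn d' n').
rewrite INR_muln INR_expn => /(ln_le _).
rewrite ln_mult; try exact: INR_gt0 (fact_gt0 _); try exact: INR_gt0.
rewrite ln_pow; last exact: INR_gt0.
have -> : INR n' = INR n'.+1 - 1 by rewrite S_INR; lra.
have [_ F] := ln_fact_bounds n'.
by move=> /(_ (pow_lt _ _ (INR_gt0 (isT : (0 < d'.+1)%N)))); nra.
Qed.

(** Factoring [y] out of [y + x ^ 2] and using [ln (1 + t) <= t] isolates an error governed by
    [x ^ 2 / y], small in (b) and bounded in (c). *)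
Lemma ln_p_upper_ratio :
  ln (INR (p d n)) <= (x - 1) * (ln y - ln x + 1) + x * (x ^ 2 / y) + 1.
Proof.
apply: Rle_trans ln_p_upper _.
have q0 : 0 <= x ^ 2 / y by apply: Rle_mult_inv_pos; nra.
have -> : y + x ^ 2 = y * (1 + x ^ 2 / y) by field; lra.
rewrite ln_mult; try lra.
have : ln (1 + x ^ 2 / y) <= 1 + x ^ 2 / y - 1 by apply: ln_le_sub1; lra.
by nra.
Qed.

(** With [M] possible edges, [M >= r ^ 2 / 4] as [r >= 2], and [j <= x] chosen edges, the number of
    graphs is at least [(M / j) ^ j]. The last hypothesis ensures [j <= M]. *)
Lemma ln_p_lower_graph r : (1 < r)%N -> (r <= d)%N -> (r < n)%N -> 4 * x <= INR r ^ 2 ->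
  (x - 1 - INR r) * (2 * ln (INR r) - ln 4 - ln x) <= ln (INR (p d n)).
Proof.
move=> r1 rd rn xr; set M := 'C(r, 2); set j := (n.-1 - r)%N.
have r2 : 2 <= INR r by apply: (@leq_INR 2).
have M4 : INR r ^ 2 <= 4 * INR M.
  have := congr1 INR (bin2_double r); rewrite !INR_muln -/M -subn1.
  by rewrite INR_subn ?(ltnW r1) //= ; nra.
have jx : INR j = x - 1 - INR r.
  by rewrite /j !INR_subn -?subn1 ?INR_subn //; try lia; rewrite /=.
have jM : (j <= M)%N.
  by apply/leP/INR_le; have := INR_ge1 (ltnW r1); lra.
have P : INR M ^ j <= INR (p d n) * INR j ^ j.
  rewrite -!INR_expn -INR_muln; apply: leq_INR.
  apply: leq_trans (expn_le_bin jM) _; rewrite leq_mul2r; apply/orP; right.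
  rewrite -[n in p d n]prednK //; apply: p_lower_graph; lia.
(* For [j = 0] the bound is [0 <= ln (p d n)]; otherwise [ln j] makes sense. *)
case: (posnP j) => [j_0|j0].
  rewrite -jx j_0 /= Rmult_0_l -ln_1; apply: ln_le; first lra.
  exact/INR_ge1/p_gt0.
have J := INR_gt0 j0; have PP := INR_gt0 p_gt0; have MM : 0 < INR M by nra.
have := ln_le (pow_lt _ j MM) P; rewrite ln_mult //; last exact: pow_lt.
rewrite !ln_pow // -jx => L.
have lj : ln (INR j) <= ln x by apply: ln_le; lra.
have lM : 2 * ln (INR r) - ln 4 <= ln (INR M).
  have <- : ln (INR r ^ 2 / 4) = 2 * ln (INR r) - ln 4.
    by rewrite ln_div ?ln_pow /=; nra.
  by apply: ln_le; nra.
by nra.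
Qed.

End Bounds.

(** * Asymptotics *)

Definition eventually (P : nat -> Prop) := exists N, forall n, (N <= n)%N -> P n.

Lemma eventually_and P Q :
  eventually P -> eventually Q -> eventually (fun n => P n /\ Q n).
Proof.
move=> [N HN] [M HM]; exists (maxn N M) => n; rewrite geq_max => /andP[Nn Mn].
by split; [apply: HN | apply: HM].
Qed.

Lemma eventually_mono (P Q : nat -> Prop) :
  (forall n, P n -> Q n) -> eventually P -> eventually Q.
Proof. by move=> PQ [N HN]; exists N => n /HN/PQ. Qed.

Lemma Un_cv_eventually u l :
  Un_cv u l <-> forall e, 0 < e -> eventually (fun n => Rabs (u n - l) < e).
Proof.
split=> H e e0; have [N HN] := H e e0; exists N => n Nn; apply: HN; first exact/leP.
exact/leP.
Qed.

Lemma eventually_gt K : eventually (fun n => K < INR n).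
Proof.
have [N HN] := INR_unbounded K; exists N => n /leq_INR; lra.
Qed.

Lemma exists_INR_ceil y : 0 < y -> exists r, y <= INR r < y + 1.
Proof.
move=> y0; have [N /Rlt_le] := INR_unbounded y.
elim: N => [|N IH]; first by move=> /= ?; exfalso; lra.
rewrite S_INR => yN; case: (Rle_dec y (INR N)) => [/IH // | Ny].
by exists N.+1; rewrite S_INR; lra.
Qed.

Lemma eventually_ln_gt K : eventually (fun n => K < ln (INR n)).
Proof.
apply: eventually_mono (eventually_gt (exp K)) => n Kn.
by rewrite -[K]ln_exp; apply: ln_increasing => //; apply: exp_pos.
Qed.

(** Write [ln x = ln (2/e) + ln (e x / 2)]: the second term is below [e x / 2], the first also once
    [x] is large. *)
Lemma eventually_ln_lt e : 0 < e -> eventually (fun n => ln (INR n) < e * INR n).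
Proof.
move=> e0; set K := ln (2 / e).
have := eventually_and (eventually_gt 0) (eventually_gt (2 * K / e)).
apply: eventually_mono => n [x0 xK]; move: (INR n) x0 xK => x x0 xK.
have e2 : 0 < 2 / e by apply: Rdiv_lt_0_compat; lra.
have ex : 0 < e / 2 * x by apply: Rmult_lt_0_compat; lra.
have : ln (2 / e * (e / 2 * x)) = ln x by congr ln; field; lra.
rewrite ln_mult // -/K; have := ln_le_sub1 ex.
have : 2 * K / e * e < x * e by apply: Rmult_lt_compat_r.
have -> : 2 * K / e * e = 2 * K by field; lra.
lra.
Qed.

Lemma Rabs_quotient_lt a b e : 0 < b -> - (e * b) < a < e * b -> Rabs (a / b) < e.
Proof.
move=> b0 ab; have abE : a = a / b * b by field; lra.
by apply: Rabs_def1; apply: (Rmult_lt_reg_r b) => //; lra.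
Qed.

Lemma p_asymptotics_large d : (forall n, (0 < d n)%N) ->
  (forall M, eventually (fun n => M < INR (d n) / INR n ^ 2)) ->
  Un_cv (fun n => (ln (INR (p (d n) n))
                   - (INR n - 1) * (ln (INR (d n)) - ln (INR n) + 1)) / INR n) 0.
Proof.
move=> d0 dbig; apply/Un_cv_eventually => e e0.
(* The upper error [x (x ^ 2 / y) + 1] is split in halves: [x > 2 / e] bounds 1 by [e x / 2], and
   [y / x ^ 2 > 2 / e] bounds the rest. *)
have := eventually_and (eventually_and (eventually_gt 0) (eventually_gt (2 / e)))
          (eventually_and (dbig (2 / e)) (eventually_ln_lt e0)).
apply: eventually_mono => n [[n0 ne] [dn lne]].
have n0' : (0 < n)%N by apply/ltP/INR_lt.
have lo := ln_p_lower (d0 n) n0'; have up := ln_p_upper_ratio (d0 n) n0'.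
rewrite Rminus_0_r; have y0 := INR_gt0 (d0 n).
set z := ln _ - _ * _; have zlo : - ln (INR n) <= z by rewrite /z; lra.
have zup : z <= INR n * (INR n ^ 2 / INR (d n)) + 1 by rewrite /z; lra.
move: zlo zup n0 ne dn lne y0; move: z (INR n) (INR (d n)) => z x y.
move=> zlo zup x0 xe yx lx y0.
have xe1 : 2 < e * x.
  by have := Rmult_lt_compat_l _ _ _ e0 xe; have -> : e * (2 / e) = 2 by field; lra.
have ratio : x ^ 2 / y < e / 2.
  have x2 : 0 < x ^ 2 by apply: pow_lt.
  apply: (Rmult_lt_reg_r (y / x ^ 2)); first by apply: Rdiv_lt_0_compat.
  have -> : x ^ 2 / y * (y / x ^ 2) = e / 2 * (2 / e) by field; lra.
  by apply: Rmult_lt_compat_l; lra.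
have := Rmult_lt_compat_l _ _ _ x0 ratio.
by move=> ?; apply: Rabs_quotient_lt => //; lra.
Qed.

Lemma p_asymptotics_square d c C : 0 < c -> 0 < C -> (forall n, (0 < d n)%N) ->
  eventually (fun n => c * INR n ^ 2 <= INR (d n) <= C * INR n ^ 2) ->
  exists K, eventually (fun n =>
    Rabs (ln (INR (p (d n) n)) - INR n * ln (INR n)) <= K * INR n).
Proof.
(* The logarithms come from [ln y = 2 ln x + O(1)], [1 / c] from [x ^ 2 / y], and 4 absorbs the
   constants and multiples of [ln x <= x - 1]. *)
move=> c0 C0 d0 dcC; exists (Rabs (ln c) + Rabs (ln C) + 1 / c + 4).
have := eventually_and (eventually_gt 0) dcC; apply: eventually_mono => n [x0 [cd dC]].
have n0 : (0 < n)%N by apply/ltP/INR_lt.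
have lo := ln_p_lower (d0 n) n0; have up := ln_p_upper_ratio (d0 n) n0.
have x1 := INR_ge1 n0; have y0 := INR_gt0 (d0 n).
move: (ln (INR (p _ _))) (INR n) (INR (d n)) lo up x0 cd dC x1 y0 => z x y.
move=> lo up x0 cd dC x1 y0; have x2 : 0 < x ^ 2 by apply: pow_lt.
have lcd := ln_le (Rmult_lt_0_compat _ _ c0 x2) cd; have ldC := ln_le y0 dC.
rewrite ln_mult // ln_pow //= in lcd; rewrite ln_mult // ln_pow //= in ldC.
have ratio : x ^ 2 / y <= 1 / c.
  apply: (Rmult_le_reg_r (y * c)); first nra.
  have -> : x ^ 2 / y * (y * c) = c * x ^ 2 by field; lra.
  by have -> : 1 / c * (y * c) = y by field; lra.
have lx := ln_le_sub1 x0.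
have := Rle_abs (ln C); have := Rle_abs (- ln c); rewrite Rabs_Ropp => absc absC.
have := Rabs_pos (ln C); have := Rabs_pos (ln c) => pc pC.
move: (Rabs (ln c)) (Rabs (ln C)) absc absC pc pC => a b absc absC pc pC.
have c1 : 0 < 1 / c by apply: Rdiv_lt_0_compat; lra.
have := Rmult_le_compat_l _ _ _ (Rlt_le _ _ x0) ratio => xr.
have D1 : (x - 1) * (ln y - ln x + 1) <= (x - 1) * (ln x + b + 1).
  by apply: Rmult_le_compat_l; lra.
have D2 : (x - 1) * (ln x - a + 1) <= (x - 1) * (ln y - ln x + 1).
  by apply: Rmult_le_compat_l; lra.
have l0 : 0 <= ln x by rewrite -ln_1; apply: ln_le; lra.
by apply: Rabs_le; split; nra.
Qed.

(** The upper bound uses [d + n ^ 2 <= 2 n ^ 2]. The lower bound takes graphs on [r] vertices, [r]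
    being [n ^ (1 - e)] rounded up; the condition on [ln d] makes room for them. *)
Lemma p_asymptotics_small d g : (forall n, (0 < d n)%N) ->
  eventually (fun n => INR (d n) <= INR n ^ 2) ->
  Un_cv (fun n => g n / ln (INR n)) 0 ->
  eventually (fun n => ln (INR n) + g n <= ln (INR (d n))) ->
  Un_cv (fun n => (ln (INR (p (d n) n)) - INR n * ln (INR n))
                  / (INR n * ln (INR n))) 0.
Proof.
move=> d0 dn2 /Un_cv_eventually g0 dg; apply/Un_cv_eventually => eps eps0.
(* The lower bound loses a factor [1 - 4 e], so [5 e <= eps] leaves a margin; [e <= 1/5] keeps
   [1 - 3 e] positive. *)
pose e := Rmin eps 1 / 5.
have [e0 e1 ee] : [/\ 0 < e, e <= 1 / 5 & 5 * e <= eps].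
  by rewrite /e /Rmin; case: Rle_dec => ?; split; lra.
have ev := eventually_and (eventually_and dn2 (eventually_and (g0 e e0) dg))
  (eventually_and (eventually_gt (4 / e)) (eventually_ln_gt (8 / (e * e)))).
apply: eventually_mono ev => n [[dn [gn dgn]] [ne lne]].
have x0 : 0 < INR n by have : 0 < 4 / e by [apply: Rdiv_lt_0_compat; lra]; lra.
have n0 : (0 < n)%N by apply/ltP/INR_lt.
have ex : 4 < e * INR n.
  by have := Rmult_lt_compat_l _ _ _ e0 ne; have -> : e * (4 / e) = 4 by field; lra.
have eel : 8 < e * e * ln (INR n).
  have := Rmult_lt_compat_l _ _ _ (Rmult_lt_0_compat _ _ e0 e0) lne.
  by have -> : e * e * (8 / (e * e)) = 8 by field; lra.
have l0 : 0 < ln (INR n).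
  by apply: Rlt_trans lne; apply: Rdiv_lt_0_compat; [lra | apply: Rmult_lt_0_compat].
have el : 8 < e * ln (INR n).
  have el0 := Rmult_lt_0_compat _ _ e0 l0.
  by have := Rmult_le_compat_l _ _ _ (Rlt_le _ _ el0) e1; lra.
have xl : 0 < INR n * ln (INR n) by apply: Rmult_lt_0_compat.
have l4 : ln 4 <= 3 by have := @ln_le_sub1 4; lra.
have l2 : ln 2 <= 1 by have := @ln_le_sub1 2; lra.
have up : ln (INR (p (d n) n)) <= INR n * ln (INR n) + 2 * INR n.
  apply: Rle_trans (ln_p_upper (d0 n) n0) _.
  have : ln (INR (d n) + INR n ^ 2) <= ln 2 + 2 * ln (INR n).
    have -> : ln 2 + 2 * ln (INR n) = ln (2 * INR n ^ 2).
      by rewrite ln_mult ?ln_pow /=; nra.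
    by apply: ln_le; [have := INR_gt0 (d0 n); nra | lra].
  by have := INR_ge1 n0; nra.
have lo : (1 - 4 * e) * (INR n * ln (INR n)) <= ln (INR (p (d n) n)).
  have lnd : (1 - e) * ln (INR n) <= ln (INR (d n)).
    have := Rabs_def2 _ _ gn; rewrite Rminus_0_r => -[_ gl].
    have := Rmult_lt_compat_r _ _ _ l0 gl.
    have -> : g n / ln (INR n) * ln (INR n) = g n by field; lra.
    lra.
  set y := exp ((1 - e) * ln (INR n)).
  have y0 : 0 < y by apply: exp_pos.
  (* [y / n = n^(-e)] is small, by [1 + e ln n <= n^e]. *)
  have yn : y <= e / 4 * INR n.
    have : y * exp (e * ln (INR n)) = INR n.
      by rewrite -exp_plus -{3}[INR n]exp_ln //; congr exp; lra.
    have := exp_ineq1_le (e * ln (INR n)) => ex1 yx.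
    have := Rmult_le_compat_l _ _ _ (Rlt_le _ _ y0) ex1; rewrite yx => y1.
    have xe : y * (e * ln (INR n)) <= INR n by lra.
    have : y * (e * e * ln (INR n)) <= e * INR n.
      by have := Rmult_le_compat_l _ _ _ (Rlt_le _ _ e0) xe; lra.
    by have : y * 8 <= y * (e * e * ln (INR n)); [apply: Rmult_le_compat_l; lra | lra].
  have yd : y <= INR (d n).
    rewrite /y -[INR (d n)]exp_ln; last exact: INR_gt0.
    by case: lnd => [lt|->]; [left; apply: exp_increasing | right].
  have [r [yr ry]] := exists_INR_ceil y0.
  have lr : (1 - e) * ln (INR n) <= ln (INR r) by have := ln_le y0 yr; rewrite /y ln_exp.
  have rd : (r <= d n)%N.
    by rewrite -ltnS; apply/ltP/INR_lt; rewrite S_INR; lra.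
  have rn : (r < n)%N by apply/ltP/INR_lt; have := Rmult_le_compat_r _ _ _ (Rlt_le _ _ x0) e1; lra.
  have r1 : (1 < r)%N.
    apply/ltP/INR_lt; rewrite /=.
    have : 0 < (1 - e) * ln (INR n) by apply: Rmult_lt_0_compat; lra.
    by have := exp_ineq1_le ((1 - e) * ln (INR n)); rewrite -/y; lra.
  have rr : 4 * INR n <= INR r ^ 2.
    apply: (Rle_trans _ (y ^ 2)); last by apply: pow_incr; lra.
    (* Since [y = n ^ (1 - e)], the square exceeds [n] by a factor [n ^ (1 - 2 e)], which is at
       least 4 here. *)
    have -> : y ^ 2 = INR n * exp ((1 - 2 * e) * ln (INR n)).
      rewrite -{1}[INR n]exp_ln // -exp_plus /y /= Rmult_1_r -exp_plus.
      by congr exp; lra.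
    have : 4 <= exp ((1 - 2 * e) * ln (INR n)).
      apply: Rle_trans (exp_ineq1_le _).
      have : e * ln (INR n) <= 1 / 5 * ln (INR n) by apply: Rmult_le_compat_r; lra.
      lra.
    by nra.
  apply: Rle_trans (ln_p_lower_graph (d0 n) n0 r1 rd rn rr).
  have A : (1 - e) * INR n <= INR n - 1 - INR r by lra.
  have B : (1 - 3 * e) * ln (INR n) <= 2 * ln (INR r) - ln 4 - ln (INR n) by lra.
  have A0 : 0 <= (1 - e) * INR n by apply: Rmult_le_pos; lra.
  have B0 : 0 <= (1 - 3 * e) * ln (INR n) by apply: Rmult_le_pos; lra.
  apply: Rle_trans (Rmult_le_compat _ _ _ _ A0 B0 A B).
  have : 0 <= e * e * (INR n * ln (INR n)).
    by apply: Rmult_le_pos; [apply: Rmult_le_pos; lra | lra].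
  lra.
have : 5 * e * (INR n * ln (INR n)) <= eps * (INR n * ln (INR n)).
  by apply: Rmult_le_compat_r; lra.
have : INR n * 8 < INR n * (e * ln (INR n)) by apply: Rmult_lt_compat_l.
by rewrite Rminus_0_r => bound1 bound2; apply: Rabs_quotient_lt => //; lra.
Qed.

Close Scope R_scope.

Theorem theorem2 :
  (* (a) *)
  (forall n d : nat, (0 < n)%N -> (0 < d)%N ->
     (INR n ^ 3 / 2 < INR d)%R ->
     (1 <= INR (p d n) / INR 'C(d + n - 2, d - 1))%R /\
     (INR (p d n) / INR 'C(d + n - 2, d - 1) < 1 / (1 - INR n ^ 3 / (2 * INR d)))%R)
  /\
  (* (b) *)
  (forall d : nat -> nat, (forall n, (0 < d n)%N) ->
     (forall M : R, exists N : nat, forall n : nat, (N <= n)%N ->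
        (M < INR (d n) / INR n ^ 2)%R) ->
     Un_cv (fun n => (ln (INR (p (d n) n))
                      - (INR n - 1) * (ln (INR (d n)) - ln (INR n) + 1)) / INR n)%R
           0%R)
  /\
  (* (c) *)
  (forall d : nat -> nat, (forall n, (0 < d n)%N) ->
     (exists c C : R, (0 < c)%R /\ (0 < C)%R /\
        exists N0 : nat, forall n : nat, (N0 <= n)%N ->
          (c * INR n ^ 2 <= INR (d n))%R /\ (INR (d n) <= C * INR n ^ 2)%R) ->
     exists K : R, exists N : nat, forall n : nat, (N <= n)%N ->
       (Rabs (ln (INR (p (d n) n)) - INR n * ln (INR n)) <= K * INR n)%R)
  /\
  (* (d) *)
  (forall d : nat -> nat, (forall n, (0 < d n)%N) ->
     Un_cv (fun n => INR (d n) / INR n ^ 2)%R 0%R ->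
     (exists g : nat -> R,
        Un_cv (fun n => g n / ln (INR n))%R 0%R /\
        exists N0 : nat, forall n : nat, (N0 <= n)%N ->
          (ln (INR n) + g n <= ln (INR (d n)))%R) ->
     Un_cv (fun n => (ln (INR (p (d n) n)) - INR n * ln (INR n))
                     / (INR n * ln (INR n)))%R 0%R).
Proof.
split; [|split; [|split]].
- move=> [//|n] [//|d] _ _ nd.
  have -> : d.+1 + n.+1 - 2 = d + n by lia.
  have -> : d.+1 - 1 = d by lia.
  (* The hypothesis with denominators cleared, the form in which the integer estimate applies. *)
  have Q : n.+1 ^ 3 < 2 * d.+1.
    by apply/ltP/INR_lt; rewrite INR_expn INR_muln (_ : INR 2 = 2%R) //; lra.
  have B0 : (0 < INR 'C(d + n, d))%R by apply: INR_gt0; rewrite bin_gt0 leq_addr.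
  have := leq_INR (p_lower_axis d n); have /ltP/lt_INR := p_upper_ratio Q.
  rewrite !INR_muln (INR_subn (ltnW Q)) INR_expn INR_muln (_ : INR 2 = 2%R) //.
  have y0 : (0 < INR d.+1)%R by apply: INR_gt0.
  move: (INR (p _ _)) (INR 'C(_, _)) (INR d.+1) (INR n.+1) B0 y0 nd => P B y x B0 y0 nd up lo.
  have Bx : (0 < 2 * y - x ^ 3)%R by lra.
  split.
    apply: (Rmult_le_reg_r B) => //; have -> : (P / B * B = P)%R by field; lra.
    lra.
  have -> : (1 / (1 - x ^ 3 / (2 * y)) = 2 * y / (2 * y - x ^ 3))%R by field; lra.
  apply: (Rmult_lt_reg_r (B * (2 * y - x ^ 3))); first exact: Rmult_lt_0_compat.
  have -> : (P / B * (B * (2 * y - x ^ 3)) = P * (2 * y - x ^ 3))%R by field; lra.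
  have -> : (2 * y / (2 * y - x ^ 3) * (B * (2 * y - x ^ 3)) = 2 * y * B)%R by field; lra.
  lra.
- move=> d d0 dbig; exact: p_asymptotics_large.
- move=> d d0 [c [C [c0 [C0 dcC]]]]; exact: p_asymptotics_square c0 C0 d0 dcC.
- move=> d d0 dn2 [g [g0 dg]]; apply: p_asymptotics_small d0 _ g0 dg.
  (* Tolerance 1 in the limit gives [d <= n ^ 2] eventually. *)
  have := eventually_and (eventually_gt 0) (proj1 (Un_cv_eventually _ _) dn2 1%R Rlt_0_1).
  apply: eventually_mono => n [x0]; rewrite Rminus_0_r => /Rabs_def2[dn _].
  have x2 := pow_lt _ 2 x0.
  have := Rmult_lt_compat_r _ _ _ x2 dn.
  have -> : (INR (d n) / INR n ^ 2 * INR n ^ 2 = INR (d n))%R by field; lra.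
  lra.
Qed.
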